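(* Assume that for every $a\in I$ the price process $S^a$ is progressively measurable (with respect to $\mathfrak G$) and has a last element $S^a_\infty$ that is $\mathcal G_\infty$-measurable. Let ${\bm\pi}=(\pi^a)_{a\in I}$ be a family of order execution delays. Then the ${\bm\pi}$-delayed market $((S^{a,\pi^a})_{a\in I},\mathfrak F,\mathfrak G^{\bm\pi},T)$ is a standard platonic market.
   Context: **Standard platonic market.** Let $T\in(0,\infty]$. A bundle $((X^a)_{a\in I},\mathfrak F,\mathfrak K,T)$ on a probability space $(\Omega,\mathcal G,\mathbb P)$ is called a standard platonic market if: $\mathfrak K=(\mathcal K_t)_{t\in[0,T]}$ is a filtration; for every $a$ in the (arbitrary, possibly uncountable) set $I$, $X^a=(X^a_t)_{t\in[0,T]}$ is a $\mathfrak K$-adapted stochastic process; and $\mathfrak F=(\mathfrak F^A)$ is a family of filtrations $\mathfrak F^A=(\mathcal F^A_t)_{t\in[0,T]}$, for finite $A\subseteq I$, with $\mathfrak F^A\subseteq\mathfrak K$ (i.e. $\mathcal F^A_t\subseteq\mathcal K_t$ for all $t\in[0,T]$), which agrees with the index system. Here an index system is a sequence $(\mathcal A^n)_{n\in\mathbb N}$, with $\mathcal A=\bigcup_n\mathcal A^n$, such that (i) $\mathcal A^n\subseteq\{A\subseteq I:|A|=n\}$; (ii) $A_1,A_2\in\mathcal A$ implies $A_1\cup A_2\in\mathcal A$; (iii) $A_1\subseteq A_2$ in $\mathcal A$ implies $\mathfrak F^{A_1}\subseteq\mathfrak F^{A_2}$ (agreement). **Setting.** Let $(\Omega,\mathcal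 G,\mathfrak G,\mathbb P)$ be a filtered probability space with $\mathfrak G=(\mathcal G_t)$ indexed by $\mathbb R_+\cup\{\infty\}$, $\mathcal G=\mathcal G_\infty$, and let $S^a$, $a\in I$, be real-valued $\mathfrak G$-adapted processes indexed by $\mathbb R_+\cup\{\infty\}$. Let $(\mathfrak F^A)$ be trading filtrations with $\mathfrak F^A\subseteq\mathfrak G$ on $[0,T]$ and let an index system agreeing with them be fixed, so that $((S^a)_{a\in I},\mathfrak F,\mathfrak G,T)$ (restricted to $[0,T]$) is a standard platonic market. **Order execution delay.** A pair $(\mathfrak I,\pi)$, with $\mathfrak I=(\mathcal I_t)_{t\in\mathbb R_+}\subseteq\mathfrak G$ a filtration (the delay information) and $\pi=(\pi(t))_{t\in[0,T]}$ a real-valued process, is an order execution delay if (i) each $\pi(t)$ is an $\mathfrak I$-stopping time; (ii) $t\le\pi(t)$ for all $t\in[0,T]$; (iii) $\pi(t)\le\pi(u)$ for all $0\le t\le u\le T$. For a family ${\bm\pi}=(\pi^a)_{a\in I}$ of execution delays, $S^{a,\pi^a}_t:=S^a_{\pi^a(t)}$ for $t\in[0,T]$, and $\mathfrak G^{\bm\pi}=(\mathcal G^{\bm\pi}_t)_{t\in[0,T]}$ with $\mathcal G^{\bm\pi}_t=\sigma\big(\bigcup_{a\in I}\mathcal G_{\pi^a(t)}\big)$, where $\mathcal G_\tau$ denotes the $\sigma$-field of the $\tau$-past of a stopping time $\tau$.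
   Formalization: The index set I of assets is assumed nonempty: for I empty the delayed filtration is trivial, while the trading filtration of the empty set need not be, so the claim fails. *)

(* Defs.v *)
From mathcomp Require Import all_boot all_order all_algebra.
From mathcomp Require Import all_classical all_reals all_analysis.

Set Implicit Arguments.
Unset Strict Implicit.
Unset Printing Implicit Defensive.

Import Order.TTheory GRing.Theory Num.Theory.
Import numFieldNormedType.Exports.

Local Open Scope classical_set_scope.
Local Open Scope ring_scope.
Local Open Scope ereal_scope.

(* A time set is a subset J of \bar R.  Processes and filtrations are total
   functions of t : \bar R, of which only the values at t \in J matter.
   Sigma-algebras are set systems on Omega (sub-sigma-algebras of
   [measurable]); processes are functions of time and state. *)
Section stochastic_basis.
Context {R : realType} {d : measure_display} {Omega : measurableType d}.

Definition time_halfline : set (\bar R) := [set t | 0 <= t < +oo].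

Definition time_compact : set (\bar R) := [set t | 0 <= t].

(* includes the point +oo when T = +oo *)
Definition time_upto (T : \bar R) : set (\bar R) := [set t | 0 <= t <= T].

Record is_filtration (J : set (\bar R))
    (F : \bar R -> set_system Omega) : Prop := {
  filtration_sigma_algebra : forall t, J t -> sigma_algebra setT (F t) ;
  filtration_measurable : forall t, J t -> F t `<=` measurable ;
  filtration_monotone :
    forall s t, J s -> J t -> s <= t -> F s `<=` F t }.

Definition sub_filtration (J : set (\bar R))
    (F G : \bar R -> set_system Omega) : Prop :=
  forall t, J t -> F t `<=` G t.

(* f is measurable from (Omega, H) to the Borel line; the set system of
   [g_sigma_algebraType H] is <<s H >>, i.e. H if H is a sigma-algebra. *)
Definition measurable_wrt (H : set_system Omega) (f : Omega -> R) : Prop :=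
  measurable_fun setT (f : g_sigma_algebraType H -> R).

Definition adapted (J : set (\bar R)) (F : \bar R -> set_system Omega)
    (X : \bar R -> Omega -> R) : Prop :=
  forall t, J t -> measurable_wrt (F t) (X t).

(* For every t in R_+, the map (s, w) |-> X_s(w) on [0, t] x Omega is
   measurable for Borel([0, t]) (x) F_t. *)
Definition progressively_measurable (F : \bar R -> set_system Omega)
    (X : \bar R -> Omega -> R) : Prop :=
  forall t : R, (0 <= t)%R ->
    measurable_fun ([set` `[0%R, t]] `*` setT)
      (fun z : R * g_sigma_algebraType (F t%:E) => X z.1%:E z.2).

(* stopping times may take the value +oo *)
Definition is_stopping_time (F : \bar R -> set_system Omega)
    (tau : Omega -> \bar R) : Prop :=
  (forall w, 0 <= tau w) /\
  (forall t, time_halfline t -> F t [set w | tau w <= t]).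

Definition tau_past (F : \bar R -> set_system Omega)
    (tau : Omega -> \bar R) : set_system Omega :=
  [set A | F +oo A /\
    forall t, time_halfline t -> F t (A `&` [set w | tau w <= t])].

End stochastic_basis.

Section platonic_market.
Context {R : realType} {d : measure_display} {Omega : measurableType d}
  {I : Type}.

Definition index_union (An : nat -> set (set I)) : set (set I) :=
  \bigcup_n An n.

Record is_index_system (An : nat -> set (set I)) : Prop := {
  index_card : forall n A, An n A -> (A #= `I_n)%card ;
  index_setU : forall A B,
    index_union An A -> index_union An B -> index_union An (A `|` B) }.

Definition agrees_with_index_system (T : \bar R)
    (F : set I -> \bar R -> set_system Omega)
    (An : nat -> set (set I)) : Prop :=
  forall A B, index_union An A -> index_union An B -> A `<=` B ->
    sub_filtration (time_upto T) (F A) (F B).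

(* F A is the trading filtration of A; only finite A matter. *)
Record standard_platonic_market (An : nat -> set (set I))
    (X : I -> \bar R -> Omega -> R)
    (F : set I -> \bar R -> set_system Omega)
    (K : \bar R -> set_system Omega) (T : \bar R) : Prop := {
  market_horizon : 0 < T ;
  market_filtration : is_filtration (time_upto T) K ;
  market_adapted : forall a, adapted (time_upto T) K (X a) ;
  market_trading_filtration :
    forall A, finite_set A -> is_filtration (time_upto T) (F A) ;
  market_sub_filtration :
    forall A, finite_set A -> sub_filtration (time_upto T) (F A) K ;
  market_index_system : is_index_system An ;
  market_agrees : agrees_with_index_system T F An }.

(* J is the delay information, indexed by R_+.  The values of pi lie in
   [0, +oo]: t <= pi t forces the value +oo at t = T when T = +oo. *)
Record is_order_execution_delay (G : \bar R -> set_system Omega) (T : \bar R)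
    (J : \bar R -> set_system Omega) (pi : \bar R -> Omega -> \bar R) :
    Prop := {
  delay_information : is_filtration time_halfline J ;
  delay_information_sub : sub_filtration time_halfline J G ;
  delay_stopping_time :
    forall t, time_upto T t -> is_stopping_time J (pi t) ;
  delay_ge : forall t, time_upto T t -> forall w, t <= pi t w ;
  delay_monotone : forall t u, time_upto T t -> time_upto T u -> t <= u ->
    forall w, pi t w <= pi u w }.

Definition delayed_price (S : I -> \bar R -> Omega -> R)
    (pi : I -> \bar R -> Omega -> \bar R) : I -> \bar R -> Omega -> R :=
  fun a t w => S a (pi a t w) w.

Definition delayed_filtration (G : \bar R -> set_system Omega)
    (pi : I -> \bar R -> Omega -> \bar R) : \bar R -> set_system Omega :=
  fun t => <<s \bigcup_(a in [set: I]) tau_past G (pi a t) >>.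

End platonic_market.

(* Main.v *)
Require Import Defs.
From mathcomp Require Import all_boot all_order all_algebra.
From mathcomp Require Import all_classical all_reals all_analysis.

Set Implicit Arguments.
Unset Strict Implicit.
Unset Printing Implicit Defensive.

Import Order.TTheory GRing.Theory Num.Theory.
Import numFieldNormedType.Exports.

Local Open Scope classical_set_scope.
Local Open Scope ring_scope.
Local Open Scope ereal_scope.

(** The main point is that a progressively measurable process X sampled at a
   stopping time tau is measurable with respect to the tau-past.  On
   {tau <= u} with u finite, X_tau is the composition of
   w |-> (min(tau w, u), w), which is G_u-measurable, with the restriction of X
   to [0, u] x Omega.  The G_oo-measurability follows by covering Omega with
   the sets {tau <= n} and {tau = +oo}, on the latter of which the last element
   X_oo is used.  The trading filtrations stay below the delayed one because
   t <= tau implies that G_t is contained in G_tau. *)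

Section sampling.
Context {R : realType} {d : measure_display} {Omega : measurableType d}.
Implicit Types (G J : \bar R -> set_system Omega) (tau : Omega -> \bar R).

(** Rewriting with this identity lets the closure lemmas for [measurable] act on the set system
    [G t]. *)
Lemma filtration_measurableE (D : set (\bar R)) G t :
  is_filtration D G -> D t -> (G t).-sigma.-measurable = G t.
Proof.
by move=> fG Dt; apply/measurable_g_measurableTypeE/(filtration_sigma_algebra fG).
Qed.

Lemma time_halfline_compact : @time_halfline R `<=` @time_compact R.
Proof. by move=> t /andP[]. Qed.

Lemma time_upto_compact (T : \bar R) : time_upto T `<=` @time_compact R.
Proof. by move=> t /andP[]. Qed.

Lemma time_compact_pinfty : @time_compact R +oo.
Proof. by rewrite /time_compact /= leey. Qed.

Lemma is_stopping_time_sub G J tau :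
  sub_filtration time_halfline J G ->
  is_stopping_time J tau -> is_stopping_time G tau.
Proof. by move=> JG [tau0 Jtau]; split=> // t ht; exact/JG/Jtau. Qed.

(** Since {tau' <= t} lies inside {tau <= t}, intersecting A with the former is the same as
    intersecting first with the latter, and both factors then belong to [G t]. *)
Lemma tau_past_mono G tau tau' : is_filtration time_compact G ->
  is_stopping_time G tau' -> (forall w, tau w <= tau' w) ->
  tau_past G tau `<=` tau_past G tau'.
Proof.
move=> fG [_ Gtau'] le_tau A [GA At]; split=> // t ht.
have -> : A `&` [set w | tau' w <= t] =
    (A `&` [set w | tau w <= t]) `&` [set w | tau' w <= t].
  rewrite -setIA; congr (_ `&` _); apply/seteqP; split=> [w /= h|w []//].
  by split=> //; exact: le_trans (le_tau w) h.
have mE := filtration_measurableE fG (time_halfline_compact ht).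
by move: (At _ ht) (Gtau' _ ht); rewrite -mE; exact: measurableI.
Qed.

Lemma sub_tau_past G tau t : is_filtration time_compact G ->
  is_stopping_time G tau -> time_compact t -> (forall w, t <= tau w) ->
  G t `<=` tau_past G tau.
Proof.
move=> fG [_ Gtau] t0 le_tau A GA; split.
  by apply: (filtration_monotone fG t0 time_compact_pinfty _ GA); rewrite leey.
move=> u hu; have u0 := time_halfline_compact hu.
have mE := filtration_measurableE fG u0.
(* Either A already belongs to [G u], or u < t <= tau makes {tau <= u} empty. *)
have [tu|ut] := leP t u.
  move: (filtration_monotone fG t0 u0 tu GA) (Gtau _ hu).
  by rewrite -mE; exact: measurableI.
rewrite (_ : _ `&` _ = set0); first by rewrite -mE.
apply/seteqP; split=> // w [_ /= wu].
by have := lt_le_trans ut (le_tau w); rewrite ltNge wu.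
Qed.

(** Truncation at a real u makes the time finite, as needed to feed it to the real time coordinate
    of [progressively_measurable]. *)
Lemma fine_mineE (x : \bar R) (u : R) : 0 <= x -> (0 <= u)%R ->
  (fine (mine x u%:E))%:E = mine x u%:E.
Proof.
move=> x0 u0; rewrite fineK// fin_numElt.
rewrite (@lt_le_trans _ _ 0) ?ltNy0 ?le_min ?x0 ?lee_fin//=.
by rewrite (@le_lt_trans _ _ u%:E) ?ltry// ge_min lexx orbT.
Qed.

(** It suffices to test open rays above x. The complement of the preimage is {tau <= x} joined with
    everything or nothing, according to whether u <= x; in the case x < u, [G x%:E] is contained in
    [G u%:E]. *)
Lemma measurable_fine_mine G tau (u : R) : is_filtration time_compact G ->
  is_stopping_time G tau -> (0 <= u)%R ->
  measurable_fun setT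
    ((fun w => fine (mine (tau w) u%:E)) : g_sigma_algebraType (G u%:E) -> R).
Proof.
move=> fG [tau0 Gtau] u0.
have hu : time_compact u%:E by rewrite /time_compact /= lee_fin.
have mE := filtration_measurableE fG hu.
apply: (measurability _ (measurable_realfun.RGenOInfty.measurableE R)) => _ [_ [x ->] <-].
rewrite setTI preimage_itvoy -[X in measurable X]setCK; apply: measurableC.
have fin w := fine_mineE (tau0 w) u0.
have -> : ~` [set w | (x < fine (mine (tau w) u%:E))%R] =
    [set w | tau w <= x%:E] `|` [set w | (u <= x)%R].
  apply/seteqP; split=> w /=.
    by move/negP; rewrite -leNgt -lee_fin fin ge_min lee_fin => /orP[]; [left|right].
  by move=> h; apply/negP; rewrite -leNgt -lee_fin fin ge_min lee_fin; apply/orP.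
have [ux|xu] := leP u x.
  by rewrite (_ : [set w | true] = setT) ?setUT//; apply/seteqP; split.
rewrite (_ : [set w | false] = set0) ?setU0; last by apply/seteqP; split.
(* A stopping time is controlled at times in R_+ only; for x < 0 the event is empty because tau >=
   0. *)
have [x0|x0] := leP 0%R x; last first.
  rewrite (_ : [set _ | _] = set0)//; apply/seteqP; split=> // w /= wx.
  by have := le_trans (tau0 w) wx; rewrite lee_fin leNgt x0.
have hx : time_halfline x%:E by rewrite /time_halfline /= lee_fin x0 ltry.
rewrite mE; apply: (filtration_monotone fG (time_halfline_compact hx) hu).
  by rewrite lee_fin ltW.
exact: Gtau.
Qed.

Lemma progressively_measurable_sampling G tau (X : \bar R -> Omega -> R) :
  is_filtration time_compact G -> is_stopping_time G tau ->
  progressively_measurable G X -> measurable_wrt (G +oo) (X +oo) ->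
  forall B, measurable B -> tau_past G tau ((fun w => X (tau w) w) @^-1` B).
Proof.
move=> fG stau Xprog Xoo B mB; have [tau0 Gtau] := stau.
have Gle (u : R) : (0 <= u)%R ->
    G u%:E ((fun w => X (tau w) w) @^-1` B `&` [set w | tau w <= u%:E]).
  move=> u0.
  have hu : time_halfline u%:E by rewrite /time_halfline /= lee_fin u0 ltry.
  have mE := filtration_measurableE fG (time_halfline_compact hu).
  have fin w := fine_mineE (tau0 w) u0.
  pose h (w : g_sigma_algebraType (G u%:E)) :
      R * g_sigma_algebraType (G u%:E) := (fine (mine (tau w) u%:E), w).
  have mh : measurable_fun setT h.
    apply: measurable_fun_pair; last exact: measurable_id.
    exact: measurable_fine_mine.
  have mXh : measurable_fun setT
      ((fun z : R * g_sigma_algebraType (G u%:E) => X z.1%:E z.2) \o h).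
    apply: measurable_comp (Xprog u u0) mh; first exact: measurableX.
    (* The image of [h] stays in [0, u] x Omega, where progressive measurability at u applies. *)
    move=> _ [w _ <-]; split=> //=; rewrite in_itv /= -!lee_fin fin.
    by rewrite le_min tau0 lee_fin u0 /= ge_min lexx orbT.
  (* On {tau <= u} the truncation changes nothing. *)
  rewrite (_ : _ `&` _ = (fun w => X (Order.min (tau w) u%:E) w) @^-1` B
                         `&` [set w | tau w <= u%:E]); last first.
    by apply/seteqP; split=> w [/= + wu]; rewrite (min_idPl wu).
  rewrite -mE; apply: measurableI; last by rewrite mE; exact: Gtau.
  have := mXh measurableT _ mB; rewrite setTI; congr measurable.
  by apply/seteqP; split=> w /=; rewrite fin.
split; last first.
  by move=> [u| |] /andP[u0]//; rewrite lee_fin in u0 => _; exact: Gle.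
have mE := filtration_measurableE fG time_compact_pinfty.
have cover w : tau w != +oo -> exists n, tau w <= n%:R%:E.
  move: (tau0 w); case: (tau w) => [r| |]// _ _; exists (Num.truncn r).+1.
  by rewrite lee_fin ltW// truncnS_gt.
pose le_n n := [set w | tau w <= n%:R%:E].
have mono n : G n%:R%:E `<=` G +oo.
  by apply: (filtration_monotone fG _ time_compact_pinfty);
    rewrite ?leey// /time_compact /= lee_fin.
have mle_n n : (G +oo).-sigma.-measurable (le_n n).
  by rewrite mE; apply/mono/Gtau; rewrite /time_halfline /= lee_fin ler0n ltry.
have -> : (fun w => X (tau w) w) @^-1` B =
    \bigcup_n ((fun w => X (tau w) w) @^-1` B `&` le_n n) `|`
    (X +oo @^-1` B `&` ~` \bigcup_n le_n n).
  apply/seteqP; split=> w /=.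
    move=> Bw; have [[n _ wn]|nw] := pselect ((\bigcup_n le_n n) w).
      by left; exists n.
    right; split=> //; suff /eqP tauw : tau w == +oo by rewrite -tauw.
    by apply: contra_notT nw => /cover[n wn]; exists n.
  move=> [[n _ []]//|[Bw nw]]; suff /eqP -> : tau w == +oo by [].
  by apply: contra_notT nw => /cover[n wn]; exists n.
rewrite -mE; apply: measurableU.
  by apply: bigcupT_measurable => n; rewrite mE; exact/mono/Gle.
apply: measurableI; first by rewrite -[X in measurable X]setTI; exact: Xoo.
by apply: measurableC; exact: bigcupT_measurable.
Qed.

End sampling.

Theorem lemma6 (R : realType) (d : measure_display) (Omega : measurableType d)
  (P : probability Omega R)
  (I : Type) (I_nonempty : inhabited I)
  (G : \bar R -> set_system Omega)
  (G_filtration : is_filtration time_compact G)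
  (G_infty : G +oo = measurable)
  (S : I -> \bar R -> Omega -> R)
  (S_adapted : forall a, adapted time_compact G (S a))
  (T : \bar R)
  (F : set I -> \bar R -> set_system Omega)
  (An : nat -> set (set I))
  (S_market : standard_platonic_market An S F G T)
  (S_progressive : forall a, progressively_measurable G (S a))
  (S_last : forall a, measurable_wrt (G +oo) (S a +oo))
  (J : I -> \bar R -> set_system Omega)
  (pi : I -> \bar R -> Omega -> \bar R)
  (delay : forall a, is_order_execution_delay G T (J a) (pi a)) :
  standard_platonic_market An (delayed_price S pi) F (delayed_filtration G pi) T.
Proof.
(* Each delay is a stopping time of its own information [J a], hence of the larger [G]. *)
have stop a t : time_upto T t -> is_stopping_time G (pi a t).
  move=> ht; apply: is_stopping_time_sub (delay_information_sub (delay a)) _.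
  exact: (delay_stopping_time (delay a)).
split.
- exact: market_horizon S_market.
- split.
  + by move=> t _; exact: smallest_sigma_algebra.
  (* Every generator lies in [G +oo] by the first clause of [tau_past]. *)
  + move=> t _; apply: smallest_sub; first exact: sigma_algebra_measurable.
    by move=> A [a _ [GA _]]; rewrite -G_infty.
  + move=> s t hs ht st; apply: sub_sigma_algebra2 => A [a _ sA].
    exists a => //; apply: tau_past_mono sA => //; first exact: stop.
    exact: (delay_monotone (delay a)).
- move=> a t ht _ B mB; rewrite setTI.
  (* Two generated sigma-algebras are nested here: that of [measurable_wrt] around that of
     [delayed_filtration]. *)
  apply: sub_sigma_algebra; apply: sub_sigma_algebra; exists a => //.
  by apply: progressively_measurable_sampling => //; exact: stop.
- exact: market_trading_filtration S_market.
- move=> A fA t ht C FC; apply: sub_sigma_algebra.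
  (* Any single index serves: [F A t] is contained in [G t], which is contained in the past of
     [pi a t] because t <= [pi a t]. *)
  have [a] := I_nonempty; exists a => //.
  apply: (@sub_tau_past _ _ _ G (pi a t) t) => //.
  + exact: stop.
  + exact: time_upto_compact ht.
  + exact: (delay_ge (delay a)).
  + exact: (market_sub_filtration S_market fA ht).
- exact: market_index_system S_market.
- exact: market_agrees S_market.
Qed.
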